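(* For every integer $d\ge 2$ there exists $n_0=n_0(d)$ such that for all $n\ge n_0$ there is a form $p$ of degree $2d$ in $n$ variables with real coefficients that is convex as a function on $\mathbb{R}^n$ but is not a sum of squares of forms of degree $d$.
   Context: A form is a homogeneous polynomial with real coefficients. A form $p$ of degree $2d$ is a sum of squares if $p=\sum_i q_i^2$ for finitely many real forms $q_i$ of degree $d$ in the same variables. *)

(* Defs.v *)
From mathcomp Require Import all_boot all_order all_algebra.
From mathcomp Require Import interval_inference.
From mathcomp Require Import classical_sets reals convex.
From mathcomp Require Import mpoly.

Set Implicit Arguments.
Unset Strict Implicit.
Unset Printing Implicit Defensive.

Import Order.TTheory GRing.Theory Num.Theory.

Local Open Scope ring_scope.

(* The zero polynomial is [k.-homog] for every [k]. *)
Definition sum_of_squares_of_forms (R : realType) (n d : nat)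
    (p : {mpoly R[n]}) : Prop :=
  exists s : seq {mpoly R[n]},
    {in s, forall q, q \is d.-homog} /\ p = \sum_(q <- s) q ^+ 2.

(* R^n is the space of row vectors. *)
Definition poly_fun (R : realType) (n : nat) (p : {mpoly R[n]})
    (x : 'rV[R]_n) : R :=
  p.@[fun i => x 0 i].

Definition convex_poly (R : realType) (n : nat) (p : {mpoly R[n]}) : Prop :=
  convex_function (setT : set 'rV[R]_n) (poly_fun p).

Lemma convex_polyE (R : realType) (n : nat) (p : {mpoly R[n]}) :
  convex_poly p <->
  forall (x y : 'rV[R]_n) (t : R), 0 <= t <= 1 ->
    poly_fun p (t *: x + (1 - t) *: y)
     <= t * poly_fun p x + (1 - t) * poly_fun p y.
Proof.
split=> [cp x y t /andP[t0 t1] | cp t x y _ _].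
  by have := cp (Itv01 t0 t1) x y (in_setT _) (in_setT _).
by apply: (cp x y t%:num); rewrite ge0 le1.
Qed.

(* Main.v *)
Require Import Defs.
From mathcomp Require Import all_boot all_order all_algebra.
From mathcomp Require Import reals.
From mathcomp Require Import topology sequences derive exp.
From mathcomp Require Import mpoly.
From mathcomp Require Import ring lra zify.

Import Order.TTheory GRing.Theory Num.Theory.
Import normed_module.numFieldNormedType.Exports.

Set Implicit Arguments.
Unset Strict Implicit.
Unset Printing Implicit Defensive.

Local Open Scope ring_scope.

(** The form is p(x) = |x|^(2d) - eps q(x), where q(x) is the sum over the
injections f of {1..2d} into {1..n} of T(im f) x_(f 1) ... x_(f 2d), and T
attaches a sign to every subset of {1..n}.  The point is that a random T is
small in one sense and large in another.

As a 2d-linear form, T has norm at most sigma = O(sqrt n) on unit vectors, and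
as a bilinear form c, c' |-> sum T(A u B) c_A c'_B over disjoint d-subsets A, B
it has norm at most lam = O(n^(d/2)), where the constants depend on d only.
Both facts are instances of [sign_form_potential], which bounds a random
multilinear form by a union bound over a net of the unit ball; its conclusion
is phrased with a potential whose mean is small, so that one T serves for both
forms ([exists_small_signs]).

Convexity ([witness_form_convex]).  In the second difference
p(y+w) + p(y-w) - 2 p(y) the norm contributes at least
2 |w|^2 (|y|^2+|w|^2)^(d-1), in every dimension, and the multilinearity of q
bounds the second difference of q by 4^d sigma times the same quantity.  Hence
eps = 1 / (4^d sigma) makes p midpoint convex, and p is continuous.

Not a sum of squares ([witness_form_not_sos]).  Let L(f) be the sum over the
vertices x of the cube {-1,1}^n of f(x) (lam + sum_J T_J x^J), with J ranging
over the 2d-subsets.  On the cube a form h of degree d is a combination of the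
monomials c_A x^A with #|A| <= d, so the orthogonality of these monomials turns
L(h^2) into 2^n (lam sum_A c_A^2 + sum T(A u B) c_A c_B), which is nonnegative
by the choice of lam.  But |x|^2 = n on the cube, so
L(p) = 2^n (lam n^d - eps n(n-1)...(n-2d+1)).  The two terms have orders
n^(3d/2) and n^(2d-1/2), so L(p) is negative for large n as soon as d >= 2. *)

(** * Exponential moments of sign sums; Euclidean norms *)

Lemma expR_pair_le (R : realType) (x : R) :
  expR x + expR (- x) <= 2 * expR (2 * x ^+ 2).
Proof.
wlog x0 : x / 0 <= x => [hw|].
  have [|/ltW x0] := leP 0 x; first exact: hw.
  by have := hw (- x); rewrite oppr_ge0 opprK sqrrN addrC; apply.
have [x1|/ltW x1] := leP x 1; last first.
  have h : expR x <= expR (2 * x ^+ 2) by rewrite ler_expR; nra.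
  have h' : expR (- x) <= expR x by rewrite ler_expR; lra.
  lra.
(* exp(-y/2) >= 1 - y/2 yields exp y <= (1 - y/2)^-2 <= 1 + y + 2 y^2 *)
have quad (y : R) : `|y| <= 1 -> expR y <= 1 + y + 2 * y ^+ 2.
  rewrite ler_norml => /andP[y0 y1].
  have h : 1 - y / 2 <= expR (- (y / 2)) by apply: expR_ge1Dx.
  have e : expR y * expR (- (y / 2)) ^+ 2 = 1.
    rewrite expr2 -!expRD; have -> : y + (- (y / 2) - y / 2) = 0 by field.
    exact: expR0.
  have ey : expR y * (1 - y / 2) ^+ 2 <= 1.
    have h0 : 0 <= 1 - y / 2 by lra.
    by rewrite -[X in _ <= X]e ler_wpM2l ?expR_ge0// lerXn2r ?nnegrE ?expR_ge0.
  have h2 : 1 <= (1 + y + 2 * y ^+ 2) * (1 - y / 2) ^+ 2.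
    have -> : (1 + y + 2 * y ^+ 2) * (1 - y / 2) ^+ 2 =
      1 + y ^+ 2 / 2 * ((1 - y) * (5 / 2 - y)) by field.
    rewrite lerDl mulr_ge0 ?divr_ge0 ?sqr_ge0// mulr_ge0 //; lra.
  have pos : 0 < (1 - y / 2) ^+ 2 by rewrite exprn_gt0//; lra.
  by rewrite -(ler_pM2r pos) (le_trans ey).
have q1 := quad x; have q2 := quad (- x).
rewrite normrN ger0_norm // sqrrN in q1 q2.
have h : 1 + 2 * x ^+ 2 <= expR (2 * x ^+ 2) by apply: expR_ge1Dx.
have := q1 x1; have := q2 x1; lra.
Qed.

(** The subgaussian bound: the signs are independent, so the exponential moment is a
product of hyperbolic cosines, and cosh x <= exp (2 x^2). *)
Lemma sum_signs_expR (R : realType) (J : finType) (a : J -> R) :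
  \sum_(T : {ffun J -> bool}) expR (\sum_j (-1) ^+ T j * a j)
    <= 2 ^+ #|J| * expR (2 * \sum_j a j ^+ 2).
Proof.
under eq_bigr => T _ do rewrite expR_sum.
rewrite -(bigA_distr_bigA (fun j (b : bool) => expR ((-1) ^+ b * a j))).
rewrite mulr_sumr expR_sum -prodr_const -big_split /=.
apply: ler_prod => j _; rewrite big_bool expr1 expr0 mulN1r mul1r.
by rewrite addr_ge0 ?expR_ge0//= addrC expR_pair_le.
Qed.

Definition enorm (R : realType) (K : finType) (x : K -> R) : R :=
  Num.sqrt (\sum_i x i ^+ 2).

Section EuclideanNorm.
Variables (R : realType) (K : finType).
Implicit Types x y : K -> R.

Lemma sumsq_ge0 x : 0 <= \sum_i x i ^+ 2.
Proof. by apply: sumr_ge0 => i _; rewrite sqr_ge0. Qed.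

Lemma enorm_ge0 x : 0 <= enorm x.
Proof. exact: sqrtr_ge0. Qed.

Lemma enorm_sqr x : enorm x ^+ 2 = \sum_i x i ^+ 2.
Proof. by rewrite sqr_sqrtr // sumsq_ge0. Qed.

Lemma enorm_eq0 x : enorm x = 0 -> forall i, x i = 0.
Proof.
move=> x0 i; have := enorm_sqr x; rewrite x0 expr0n /= => /esym/eqP.
rewrite psumr_eq0 => [/allP/(_ i)|j _]; last exact: sqr_ge0.
by rewrite mem_index_enum sqrf_eq0 => /(_ isT)/eqP.
Qed.

Lemma sum_mul_le_enorm x y : \sum_i x i * y i <= enorm x * enorm y.
Proof.
have [x0|x0] := eqVneq (enorm x) 0.
  by rewrite x0 mul0r big1 // => i _; rewrite enorm_eq0 ?mul0r.
have [y0|y0] := eqVneq (enorm y) 0.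
  by rewrite y0 mulr0 big1 // => i _; rewrite [y i]enorm_eq0 ?mulr0.
have x1 : 0 < enorm x by rewrite lt_def x0 enorm_ge0.
have y1 : 0 < enorm y by rewrite lt_def y0 enorm_ge0.
have h : 0 <= \sum_i (enorm y * x i - enorm x * y i) ^+ 2 by exact: sumsq_ge0.
have e : \sum_i (enorm y * x i - enorm x * y i) ^+ 2 =
   2 * (enorm x * enorm y) * (enorm x * enorm y - \sum_i x i * y i).
  transitivity (enorm y ^+ 2 * (\sum_i x i ^+ 2)
     - 2 * (enorm x * enorm y) * (\sum_i x i * y i)
     + enorm x ^+ 2 * (\sum_i y i ^+ 2)); last by rewrite -!enorm_sqr; ring.
  rewrite !mulr_sumr -sumrN -!big_split /=; apply: eq_bigr => i _; ring.
rewrite e in h.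
have xy : 0 < 2 * (enorm x * enorm y) by rewrite !mulr_gt0.
by rewrite -subr_ge0 -(pmulr_rge0 _ xy).
Qed.

Lemma sqr_sum_le_card (D : pred K) x :
  (\sum_(i | D i) x i) ^+ 2 <= #|D|%:R * \sum_(i | D i) x i ^+ 2.
Proof.
set s := \sum_(i | D i) x i; set q := \sum_(i | D i) x i ^+ 2.
have [c0|c0] := posnP #|D|.
  rewrite c0 mul0r /s big_pred0 ?expr0n // => i.
  by have /card0_eq/(_ i) := c0.
set c : R := #|D|%:R; have cp : 0 < c by rewrite ltr0n.
have h : 0 <= \sum_(i | D i) (c * x i - s) ^+ 2.
  by apply: sumr_ge0 => i _; rewrite sqr_ge0.
have e u : \sum_(i | D i) (c * x i - u) ^+ 2 =
    c ^+ 2 * (\sum_(i | D i) x i ^+ 2) - 2 * c * u * (\sum_(i | D i) x i)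
      + c * u ^+ 2.
  have -> : c * u ^+ 2 = \sum_(i | D i) u ^+ 2.
    by rewrite sumr_const mulr_natl.
  rewrite !mulr_sumr -sumrN -!big_split /=; apply: eq_bigr => i _; ring.
rewrite e -/s -/q in h.
by rewrite -subr_ge0 -(pmulr_rge0 _ cp); nra.
Qed.
End EuclideanNorm.

(** * A finite net of the unit ball *)

Section Net.
Variables (R : realType) (K : finType) (Q : nat).
Hypothesis Q_gt0 : (0 < Q)%N.
Hypothesis K_le : (#|K| <= Q ^ 2)%N.

Definition net_code : finType := {ffun K -> bool * 'I_(2 * Q).+1}.

(** A code stores a sign and an integer at most 2 Q for each coordinate; it stands
for the vector with these signed integers divided by 2 Q.  Zero has two codes,
which is harmless. *)
Definition net_point (z : net_code) (i : K) : R :=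
  (-1) ^+ (z i).1 * (nat_of_ord (z i).2)%:R / (2 * Q)%:R.

(** This is the condition that the coded vector lies in the unit ball. *)
Definition in_net (z : net_code) : bool :=
  (\sum_i (nat_of_ord (z i).2) ^ 2 <= 4 * Q ^ 2)%N.

Let Q2_gt0 : 0 < (2 * Q)%:R :> R.
Proof. by rewrite ltr0n muln_gt0. Qed.

Lemma net_point_sqr z : in_net z -> \sum_i net_point z i ^+ 2 <= 1.
Proof.
move=> hz.
have -> : \sum_i net_point z i ^+ 2 =
    (\sum_i (nat_of_ord (z i).2) ^ 2)%N%:R / (2 * Q)%:R ^+ 2.
  rewrite natr_sum mulr_suml; apply: eq_bigr => i _.
  by rewrite /net_point !exprMn sqrr_sign mul1r exprVn natrX.
rewrite ler_pdivrMr ?exprn_gt0// mul1r -natrX ler_nat.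
by apply: leq_trans hz _; rewrite expnMn.
Qed.

Lemma sum_half_sqr_le n : \sum_(m < n) (1 / 2 : R) ^+ (m ^ 2) <= 2.
Proof.
have h : \sum_(m < n) (1 / 2 : R) ^+ m = 2 - 2 * (1 / 2) ^+ n.
  elim: n => [|n IH]; first by rewrite big_ord0 expr0; ring.
  by rewrite big_ord_recr /= IH exprS; field.
apply: (@le_trans _ _ (\sum_(m < n) (1 / 2 : R) ^+ m)).
  apply: ler_sum => m _; apply: ler_wiXn2l; first lra.
    lra.
  by case: (nat_of_ord m) => // k; rewrite -mulnn leq_pmull.
by rewrite h lerBlDr lerDl mulr_ge0 // exprn_ge0 //; lra.
Qed.

(** Weighting a code by 2^(-sum of the squares of its integers) makes the total
weight of all codes a product over the coordinates, at most 4^#|K|, while each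
code of a vector in the unit ball weighs at least 2^(-4 Q^2). *)
Lemma card_net : (#|in_net| <= 2 ^ (6 * Q ^ 2))%N.
Proof.
pose w (c : bool * 'I_(2 * Q).+1) : R := (1 / 2) ^+ (nat_of_ord c.2 ^ 2).
have w0 c : 0 <= w c by rewrite exprn_ge0 //; lra.
have sw : \sum_c w c <= 4.
  rewrite -(pair_bigA _ (fun (b : bool) m => w (b, m))) /= big_bool /w /=.
  by have := sum_half_sqr_le (2 * Q).+1; lra.
have tot : \sum_(z : net_code) \prod_i w (z i) <= 4 ^+ #|K|.
  rewrite -(bigA_distr_bigA (fun (_ : K) c => w c)) /= prodr_const.
  by rewrite lerXn2r ?nnegrE ?sumr_ge0.
have low : #|in_net|%:R * (1 / 2 : R) ^+ (4 * Q ^ 2) <= 4 ^+ #|K|.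
  apply: le_trans tot; rewrite mulr_natl -sumr_const.
  rewrite [leRHS](bigID in_net) /= -[leLHS]addr0 lerD //; last first.
    by rewrite sumr_ge0 // => z _; rewrite prodr_ge0.
  apply: ler_sum => z hz; rewrite /w prodrXr.
  by apply: ler_wiXn2l => //; lra.
rewrite -(ler_nat R) natrX.
have -> : (6 * Q ^ 2 = 2 * Q ^ 2 + 4 * Q ^ 2)%N by lia.
rewrite exprD -ler_pdivrMr ?exprn_gt0// -exprVn -[2^-1]mul1r.
apply: le_trans low _.
have -> : (2 : R) ^+ (2 * Q ^ 2) = 4 ^+ (Q ^ 2).
  by rewrite exprM; congr (_ ^+ _); ring.
by rewrite ler_weXn2l // ler1n.
Qed.

(** Rounding 2 Q |x i| down keeps the point in the unit ball and moves it by at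
most 1 / (2 Q) in each of at most Q^2 coordinates. *)
Lemma net_approx (x : K -> R) : \sum_i x i ^+ 2 <= 1 ->
  exists2 z, in_net z & \sum_i (x i - net_point z i) ^+ 2 <= 1 / 4.
Proof.
move=> x1; set q : R := (2 * Q)%:R.
pose m i := Num.truncn (q * `|x i|).
have qx0 i : 0 <= q * `|x i| by rewrite mulr_ge0 ?ler0n.
have xi1 i : `|x i| <= 1.
  rewrite -(@expr_le1 _ 2) // real_normK ?num_real//.
  apply: le_trans x1; rewrite (bigD1 i) //= lerDl.
  by apply: sumr_ge0 => j _; rewrite sqr_ge0.
have mle i : (m i)%:R <= q * `|x i|.
  by have /andP[] := truncn_itv (qx0 i).
have mgt i : q * `|x i| < (m i).+1%:R.
  by have /andP[] := truncn_itv (qx0 i).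
have mlt i : (m i < (2 * Q).+1)%N.
  rewrite ltnS -(ler_nat R); apply: le_trans (mle i) _.
  by rewrite -[leRHS]mulr1 ler_wpM2l ?ler0n.
exists [ffun i => (x i < 0, Ordinal (mlt i))].
  rewrite /in_net -(ler_nat R) natr_sum.
  have -> : (4 * Q ^ 2)%N%:R = q ^+ 2 by rewrite /q -natrX expnMn.
  apply: (@le_trans _ _ (q ^+ 2 * \sum_i x i ^+ 2)).
    rewrite mulr_sumr; apply: ler_sum => i _; rewrite ffunE /= natrX.
    by rewrite -[x i ^+ 2]real_normK ?num_real// -exprMn lerXn2r ?nnegrE.
  by rewrite -[leRHS]mulr1 ler_wpM2l ?sqr_ge0.
apply: (@le_trans _ _ (\sum_(i : K) q ^- 2)).
  apply: ler_sum => i _; rewrite /net_point ffunE /= -/q.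
  have e : x i - (-1) ^+ (x i < 0)%R * (m i)%:R / q =
      (-1) ^+ (x i < 0)%R * ((q * `|x i| - (m i)%:R) / q).
    by rewrite {1}[x i]numEsign mulrBl [q * _]mulrC mulfK ?gt_eqF// mulrBr mulrA.
  rewrite e exprMn sqrr_sign mul1r exprMn exprVn ler_pdivrMr ?exprn_gt0//.
  rewrite mulVf ?expf_neq0 ?gt_eqF// -[leRHS](expr1n _ 2) lerXn2r ?nnegrE ?subr_ge0//.
  by have := mgt i; rewrite -natr1 lerBlDl => /ltW.
rewrite sumr_const -[leLHS]mulr_natl ler_pdivrMr ?exprn_gt0//.
rewrite /q -natrX expnMn natrM mulrA mul1r mulVf ?pnatr_eq0// mul1r.
by rewrite ler_nat.
Qed.

(** The norm of g is its value at the unit vector u = g / |g|.  Replacing u by a point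
of the net costs at most |g| / 2, whence |g| <= C + |g| / 2. *)
Lemma net_linear_bound (g : K -> R) (C : R) :
  (forall z, in_net z -> \sum_i g i * net_point z i <= C) ->
  forall x, \sum_i g i * x i <= 2 * C * enorm x.
Proof.
move=> hC x.
suff hg : enorm g <= 2 * C.
  apply: le_trans (sum_mul_le_enorm _ _) _.
  by rewrite ler_wpM2r ?enorm_ge0.
have [g0|g0] := eqVneq (enorm g) 0.
  have [z hz _] : exists2 z, in_net z & \sum_i (0 - net_point z i) ^+ 2 <= 1 / 4.
    by apply: net_approx; rewrite big1 // => i _; rewrite expr0n.
  have := hC z hz; rewrite big1 => [|i _]; first by rewrite g0; lra.
  by rewrite enorm_eq0 ?mul0r.
have gp : 0 < enorm g by rewrite lt_def g0 enorm_ge0.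
pose u i := g i / enorm g.
have [z hz huz] : exists2 z, in_net z & \sum_i (u i - net_point z i) ^+ 2 <= 1 / 4.
  apply: net_approx; rewrite /u.
  under eq_bigr => i _ do rewrite exprMn exprVn.
  by rewrite -mulr_suml -enorm_sqr divff // expf_neq0.
have gu : enorm g = \sum_i g i * u i.
  rewrite /u; under eq_bigr => i _ do rewrite mulrA -expr2.
  by rewrite -mulr_suml -enorm_sqr expr2 mulfK.
have e : enorm g = \sum_i g i * net_point z i
    + \sum_i g i * (u i - net_point z i).
  by rewrite {1}gu -big_split /=; apply: eq_bigr => i _; rewrite -mulrDr subrKC.
have h2 : enorm (fun i => u i - net_point z i) <= 1 / 2.
  move: huz (enorm_ge0 (fun i => u i - net_point z i)).
  by rewrite -(enorm_sqr (fun i => u i - net_point z i)); nra.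
have h3 := sum_mul_le_enorm g (fun i => u i - net_point z i).
have := hC z hz; nra.
Qed.

End Net.

(** * Random multilinear forms *)

(** The coefficient of the monomial indexed by p is the sign that T attaches to
tau p, so monomials in the same fiber of tau share their sign. *)
Definition sign_form (R : realType) (P J K : finType) (D : pred P) (tau : P -> J)
    (k : nat) (pi : 'I_k -> P -> K) (T : {ffun J -> bool}) (x : 'I_k -> K -> R) : R :=
  \sum_(p | D p) (-1) ^+ T (tau p) * \prod_a x a (pi a p).

Section RandomForm.
Variables (R : realType) (P J K : finType) (D : pred P) (tau : P -> J).
Variables (k : nat) (pi : 'I_k -> P -> K) (W Q : nat).
Hypothesis fiber_le : forall j, (#|[pred p | D p && (tau p == j)]| <= W)%N.
Hypothesis pi_inj : forall p q, D p -> D q -> (forall a, pi a p = pi a q) -> p = q.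
Hypothesis k_gt0 : (0 < k)%N.
Hypothesis Q_gt0 : (0 < Q)%N.
Hypothesis K_le : (#|K| <= Q ^ 2)%N.

Local Notation form := (@sign_form R P J K D tau k pi).

Let coef (x : 'I_k -> K -> R) (j : J) : R :=
  \sum_(p | D p && (tau p == j)) \prod_a x a (pi a p).

Lemma sign_form_coef T x : form T x = \sum_j (-1) ^+ T j * coef x j.
Proof.
rewrite /sign_form (partition_big tau predT) //=; apply: eq_bigr => j _.
by rewrite mulr_sumr; apply: eq_bigr => p /andP[_ /eqP->].
Qed.

Lemma eq_sign_form T x y : (forall a, x a =1 y a) -> form T x = form T y.
Proof.
move=> xy; apply: eq_bigr => p _; congr (_ * _); apply: eq_bigr => a _.
exact: xy.
Qed.

(** Cauchy-Schwarz in each fiber of tau costs the factor W; as pi is jointly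
injective, the remaining squares are some of the terms of the expanded product. *)
Lemma sum_coef_sqr_le x :
  \sum_j coef x j ^+ 2 <= W%:R * \prod_a \sum_i x a i ^+ 2.
Proof.
apply: (@le_trans _ _
    (\sum_j W%:R * \sum_(p | D p && (tau p == j)) (\prod_a x a (pi a p)) ^+ 2)).
  apply: ler_sum => j _; apply: le_trans (sqr_sum_le_card _ _) _.
  rewrite ler_wpM2r ?ler_nat ?fiber_le//.
  by rewrite sumr_ge0 // => p _; rewrite sqr_ge0.
rewrite -mulr_sumr ler_wpM2l ?ler0n// -(partition_big tau predT) //=.
pose code p : {ffun 'I_k -> K} := [ffun a => pi a p].
have code_inj : {in D &, injective code}.
  move=> p q Dp Dq /ffunP e; apply: pi_inj => // a.
  by have := e a; rewrite !ffunE.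
pose w (f : {ffun 'I_k -> K}) := \prod_a x a (f a) ^+ 2.
rewrite (eq_bigr (w \o code)) => [|p _]; last first.
  by rewrite /= /w -prodrXl; apply: eq_bigr => a _; rewrite ffunE.
rewrite (bigA_distr_bigA (fun a i => x a i ^+ 2)) /=.
rewrite -(big_imset w code_inj) /= [leRHS](bigID (mem (code @: D))) /=.
rewrite lerDl sumr_ge0 // => f _; rewrite prodr_ge0 // => a _.
exact: sqr_ge0.
Qed.

Lemma sign_form_linear T a x : exists g : K -> R, forall w,
  form T (fun b => if b == a then w else x b) = \sum_i g i * w i.
Proof.
exists (fun i => \sum_(p | D p && (pi a p == i))
  (-1) ^+ T (tau p) * \prod_(b | b != a) x b (pi b p)) => w.
rewrite /sign_form (partition_big (pi a) predT) //=; apply: eq_bigr => i _.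
rewrite mulr_suml; apply: eq_bigr => p /andP[_ /eqP pi_i].
rewrite (bigD1 a) //= eqxx pi_i [w i * _]mulrC mulrA; congr (_ * _ * _).
by apply: eq_bigr => b /negPf->.
Qed.

Let t : R := (2 * W + 6 * k + 1)%:R * Q%:R.

Let net_args (zz : {ffun 'I_k -> net_code K Q}) (a : 'I_k) : K -> R :=
  net_point R (zz a).

Let potential (T : {ffun J -> bool}) : R :=
  \sum_(zz in ffun_on (@in_net K Q)) expR (Q%:R * (form T (net_args zz) - t)).

(** At each of the at most 2^(6 Q^2 k) tuples of net points the mean of
exp (Q form) is at most exp (2 Q^2 W).  The threshold t = (2 W + 6 k + 1) Q is
what makes exp (- Q t) beat the product of these two numbers. *)
Lemma sum_potential_le : \sum_T potential T <= 2 ^+ #|J| * expR (- 1).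
Proof.
have exp2 n : 2 ^+ n <= expR n%:R :> R.
  rewrite -[n%:R]mulr1 expRM_natl lerXn2r ?nnegrE ?expR_ge0//.
  by apply: le_trans (expR_ge1Dx 1); lra.
have Q1 : 1 <= Q%:R :> R by rewrite ler1n.
rewrite /potential exchange_big /=.
have term zz : zz \in ffun_on (@in_net K Q) ->
    \sum_T expR (Q%:R * (form T (net_args zz) - t)) <=
      2 ^+ #|J| * expR (2 * (Q%:R ^+ 2 * W%:R) - Q%:R * t).
  move=> /ffun_onP hz.
  under eq_bigr => T _ do rewrite mulrBr expRD sign_form_coef mulr_sumr.
  rewrite -mulr_suml expRD mulrA ler_wpM2r ?expR_ge0//.
  have := sum_signs_expR (fun j => Q%:R * coef (net_args zz) j).
  under eq_bigr => T _ do under eq_bigr => j _ do rewrite mulrCA.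
  move=> /le_trans; apply; rewrite ler_wpM2l ?exprn_ge0// ler_expR.
  rewrite ler_pM2l //; under eq_bigr => j _ do rewrite exprMn.
  rewrite -mulr_sumr ler_wpM2l ?sqr_ge0//.
  apply: le_trans (sum_coef_sqr_le _) _.
  rewrite -[leRHS]mulr1 ler_wpM2l ?ler0n//; apply: prodr_ile1 => a.
  by rewrite sumsq_ge0 /= net_point_sqr //; apply: hz.
apply: le_trans (ler_sum _ term) _.
rewrite sumr_const card_ffun_on card_ord -[leLHS]mulr_natl mulrCA.
rewrite ler_wpM2l ?exprn_ge0//.
apply: (@le_trans _ _ (expR (6 * Q ^ 2 * k)%:R *
    expR (2 * (Q%:R ^+ 2 * W%:R) - Q%:R * t))).
  rewrite ler_wpM2r ?expR_ge0//; apply: le_trans (exp2 _).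
  rewrite -natrX ler_nat expnM leq_exp2r //; exact: card_net.
rewrite -expRD ler_expR /t.
have -> : (6 * Q ^ 2 * k)%:R + (2 * (Q%:R ^+ 2 * W%:R) -
    Q%:R * ((2 * W + 6 * k + 1)%:R * Q%:R)) = - (Q%:R ^+ 2) :> R by ring.
by rewrite lerN2 expr_ge1 // ltW // ltr0n.
Qed.

(** Every term of the potential is below 1, so the form is at most t on the net.  The
net points are then exchanged for arbitrary vectors one argument at a time,
each exchange doubling the constant by [net_linear_bound]. *)
Lemma potential_lt1 T : potential T < 1 -> forall x,
  form T x <= 2 ^+ k * (2 * W + 6 * k + 1)%:R * Q%:R * \prod_a enorm (x a).
Proof.
move=> small x.
have net_le zz : zz \in ffun_on (@in_net K Q) -> form T (net_args zz) <= t.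
  move=> hz; have Q0 : 0 < Q%:R :> R by rewrite ltr0n.
  rewrite -subr_le0 -(pmulr_rle0 _ Q0) leNgt -expR_gt1 -leNgt.
  apply: le_trans (ltW small).
  rewrite /potential (bigD1 zz) //= lerDl sumr_ge0 // => y _.
  exact: expR_ge0.
have t0 : 0 <= t by rewrite mulr_ge0.
pose mix m zz (a : 'I_k) := if (a < m)%N then x a else net_args zz a.
have step m : (m <= k)%N -> forall zz, zz \in ffun_on (@in_net K Q) ->
    form T (mix m zz) <= 2 ^+ m * t * \prod_(a < k | (a < m)%N) enorm (x a).
  elim: m => [_ zz hz|m IH mk zz hz].
    rewrite big_pred0 // expr0 mul1r mulr1; apply: le_trans (net_le _ hz).
    by rewrite le_eqVlt (@eq_sign_form T _ (net_args zz)) ?eqxx.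
  pose am := Ordinal mk.
  have [g hg] := sign_form_linear T am (mix m zz).
  have mixS w : form T (fun b => if b == am then w else mix m zz b) =
     \sum_i g i * w i by exact: hg.
  have -> : form T (mix m.+1 zz) = \sum_i g i * x am i.
    rewrite -mixS; apply: eq_sign_form => b i; rewrite /mix.
    have [->|bm] := eqVneq b am; first by rewrite /= ltnSn.
    by rewrite ltnS leq_eqVlt (negPf (bm : (val b != m)%N)).
  rewrite (bigD1 am) //= exprS.
  have e : \prod_(a < k | (a < m.+1)%N && (a != am)) enorm (x a) =
           \prod_(a < k | (a < m)%N) enorm (x a).
    by apply: eq_bigl => a; rewrite ltnS -(inj_eq val_inj) /= andbC -ltn_neqAle.
  rewrite e; set pr := \prod_(a < k | _) _ in IH *.
  have := @net_linear_bound R K Q Q_gt0 K_le g (2 ^+ m * t * pr) _ (x am).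
  move=> h; apply: le_trans (h _) _; last by rewrite le_eqVlt; apply/orP; left; apply/eqP; ring.
  move=> z hz'; pose zz' := [ffun b => if b == am then z else zz b].
  have hzz' : zz' \in ffun_on (@in_net K Q).
    apply/ffun_onP => b; rewrite ffunE; case: ifP => // _.
    by move/ffun_onP: hz; apply.
  apply: le_trans (IH (ltnW mk) zz' hzz'); rewrite -mixS le_eqVlt.
  apply/orP; left; apply/eqP; apply: eq_sign_form => b i.
  rewrite /mix /net_args ffunE; case: eqP => [->|//].
  by rewrite /= ltnn.
pose zz : {ffun 'I_k -> net_code K Q} := [ffun _ => [ffun _ => (false, ord0)]].
have hz : zz \in ffun_on (@in_net K Q).
  apply/ffun_onP => a; rewrite unfold_in /in_net big1 // => i _.
  by rewrite !ffunE.
have -> : form T x = form T (mix k zz).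
  by apply: eq_sign_form => a i; rewrite /mix ltn_ord.
apply: le_trans (step k (leqnn k) zz hz) _.
have -> : \prod_(a < k | (a < k)%N) enorm (x a) = \prod_a enorm (x a).
  by apply: eq_bigl => a; rewrite ltn_ord.
by rewrite /t mulrA.
Qed.

(** A choice of signs that is bad for the form has potential at least 1, and the mean
potential is at most exp (-1).  Potentials of several forms can be added, which
gives signs that are good for all of them. *)
Lemma sign_form_potential : exists Phi : {ffun J -> bool} -> R,
  [/\ forall T, 0 <= Phi T, \sum_T Phi T <= 2 ^+ #|J| * expR (- 1) &
      forall T, Phi T < 1 -> forall x, form T x <=
        2 ^+ k * (2 * W + 6 * k + 1)%:R * Q%:R * \prod_a enorm (x a)].
Proof.
exists potential; split; [|exact: sum_potential_le|exact: potential_lt1].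
by move=> T; apply: sumr_ge0 => zz _; exact: expR_ge0.
Qed.

End RandomForm.

(** * Convexity of perturbed powers of the norm *)

(** If g exceeded its chord somewhere, then so would g minus the chord minus a small
multiple of t (1 - t), which is strictly midpoint convex; this is impossible at
an interior maximum. *)
Lemma poly_convex_of_midpoint (R : realType) (g : {poly R}) :
  (forall t s, 2 * g.[t] <= g.[t + s] + g.[t - s]) ->
  forall t, 0 <= t <= 1 -> g.[t] <= t * g.[1] + (1 - t) * g.[0].
Proof.
move=> mid t0 /andP[t00 t01].
pose chord := g.[1] *: 'X + g.[0] *: (1 - 'X).
have chordE t : chord.[t] = t * g.[1] + (1 - t) * g.[0].
  by rewrite /chord !hornerE mulrC [g.[0] * _]mulrC.
rewrite -chordE leNgt; apply/negP => neg.
pose del := g.[t0] - chord.[t0].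
have del0 : 0 < del by rewrite subr_gt0.
pose h := g - chord - del *: ('X * (1 - 'X)).
have hE t : h.[t] = g.[t] - chord.[t] - del * (t * (1 - t)).
  by rewrite /h !hornerE.
have [c cI cmax] := @EVT_max R (horner h) 0 1 ler01
  (continuous_subspaceT (@continuous_horner R h)).
have ht0 : h.[t0] <= h.[c] by apply: cmax; rewrite in_itv /= t00 t01.
have hpos : 0 < h.[c].
  apply: lt_le_trans ht0; rewrite hE -/del.
  have -> : del - del * (t0 * (1 - t0)) = del * (1 - t0 * (1 - t0)) by ring.
  rewrite mulr_gt0 //; nra.
have h0 : h.[0] = 0 by rewrite hE chordE; ring.
have h1 : h.[1] = 0 by rewrite hE chordE; ring.
move: cI; rewrite in_itv /= => /andP[c0 c1].
have c0' : 0 < c.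
  by rewrite lt_def c0 andbT; apply/eqP => e; move: hpos; rewrite e h0 ltxx.
have c1' : c < 1.
  by rewrite lt_def c1 andbT; apply/eqP => e; move: hpos; rewrite -e h1 ltxx.
have [s [s0 sc sc1]] : exists s, [/\ 0 < s, s <= c & s <= 1 - c].
  exists (Num.min c (1 - c)); split.
  - by rewrite lt_min c0' subr_gt0.
  - by rewrite ge_min lexx.
  - by rewrite ge_min lexx orbT.
have a1 : h.[c + s] <= h.[c] by apply: cmax; rewrite in_itv /=; lra.
have a2 : h.[c - s] <= h.[c] by apply: cmax; rewrite in_itv /=; lra.
have := mid c s; move: a1 a2; rewrite !hE !chordE.
have : 0 < del * s ^+ 2 by rewrite mulr_gt0 ?exprn_gt0.
nra.
Qed.

Lemma meval_line (R : realType) (n : nat) (p : {mpoly R[n]}) (x y : 'I_n -> R) :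
  exists g : {poly R}, forall t, p.@[fun i => t * x i + (1 - t) * y i] = g.[t].
Proof.
exists (mmap polyC (fun i => (x i - y i)%:P * 'X + (y i)%:P) p) => t.
rewrite /meval /mmap horner_sum; apply: eq_bigr => m _.
rewrite hornerM hornerC /mmap1 horner_prod; congr (_ * _); apply: eq_bigr => i _.
by rewrite horner_exp !hornerE; congr (_ ^+ _); ring.
Qed.

Lemma convex_of_midpoint (R : realType) (n : nat) (p : {mpoly R[n]}) :
  (forall y w : 'I_n -> R, 2 * p.@[y] <=
     p.@[fun i => y i + w i] + p.@[fun i => y i - w i]) ->
  convex_poly p.
Proof.
move=> mid; apply/convex_polyE => x y t t01; rewrite /poly_fun.
have [g gE] := meval_line p (fun i => x 0 i) (fun i => y 0 i).
have g1 : p.@[fun i => x 0 i] = g.[1].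
  by rewrite -gE; apply: meval_eq => i; rewrite subrr mul0r addr0 mul1r.
have g0 : p.@[fun i => y 0 i] = g.[0].
  by rewrite -gE; apply: meval_eq => i; rewrite subr0 mul0r add0r mul1r.
have -> : p.@[fun i => (t *: x + (1 - t) *: y) 0 i] = g.[t].
  by rewrite -gE; apply: meval_eq => i; rewrite !mxE.
rewrite g1 g0; apply: poly_convex_of_midpoint => // u s.
have := mid (fun i => u * x 0 i + (1 - u) * y 0 i) (fun i => s * (x 0 i - y 0 i)).
rewrite -!gE.
by congr (_ <= _ + _); apply: meval_eq => i; ring.
Qed.

(** Induction on d; the step is Chebyshev's inequality: s and
(u + s)^d - (u - s)^d have the same sign. *)
Lemma midpoint_exprn (R : realType) (u s : R) d : 0 <= u + s -> 0 <= u - s ->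
  2 * u ^+ d <= (u + s) ^+ d + (u - s) ^+ d.
Proof.
move=> hp hm; have u0 : 0 <= u by lra.
elim: d => [|d IH]; first by rewrite !expr0; lra.
have cheb : 0 <= s * ((u + s) ^+ d - (u - s) ^+ d).
  have [s0|/ltW s0] := leP 0 s.
    by rewrite mulr_ge0 // subr_ge0 lerXn2r ?nnegrE //; lra.
  by rewrite mulr_le0 // subr_le0 lerXn2r ?nnegrE //; lra.
rewrite !exprS; nra.
Qed.

Section Perturbation.
Variables (R : realType) (P J : finType) (D : pred P) (tau : P -> J).
Variables (n d : nat) (pi : 'I_(2 * d) -> P -> 'I_n) (T : {ffun J -> bool}).
Hypothesis d_gt0 : (0 < d)%N.

Local Notation form := (@sign_form R P J 'I_n D tau (2 * d) pi T).

Lemma sign_form_diag_add (y w : 'I_n -> R) (c : R) :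
  form (fun _ i => y i + c * w i) =
  \sum_(A : {set 'I_(2 * d)}) c ^+ #|A| * form (fun a => if a \in A then w else y).
Proof.
rewrite /sign_form.
transitivity (\sum_(p | D p) \sum_(A : {set 'I_(2 * d)}) (-1) ^+ T (tau p) *
   (c ^+ #|A| * \prod_a (if a \in A then w else y) (pi a p))).
  apply: eq_bigr => p _; rewrite -mulr_sumr; congr (_ * _).
  under eq_bigr => a _ do rewrite addrC.
  rewrite bigA_distr; apply: eq_bigr => A _.
  rewrite -prodr_const [X in _ = X * _]big_mkcond -big_split /=.
  by apply: eq_bigr => a _; case: (a \in A); rewrite ?mul1r.
rewrite exchange_big; apply: eq_bigr => A _ /=; rewrite mulr_sumr.
by apply: eq_bigr => p _; rewrite mulrCA.
Qed.

(** Expanding the form at y + w and y - w over the set A of arguments that receive w,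
the odd A cancel and A empty is the value at y.  With r = |y|^2, rho = |w|^2 and
u = r + rho, each nonempty even A contributes at most
2 sigma rho^j r^(d-j) <= 2 sigma rho u^(d-1), where #|A| = 2 j, and the norm gains
at least 2 (u^d - r^d) >= 2 rho u^(d-1). *)
Lemma perturbed_norm_midpoint (sigma eps : R) (y w : 'I_n -> R) :
  0 <= sigma -> 0 <= eps -> eps * sigma * 4 ^+ d <= 1 ->
  (forall x, form x <= sigma * \prod_a enorm (x a)) ->
  let f z := (\sum_i z i ^+ 2) ^+ d - eps * form (fun=> z) in
  is_true (2 * f y <= f (fun i => y i + w i) + f (fun i => y i - w i)).
Proof.
move=> sigma0 eps0 small bound f.
set r := \sum_i y i ^+ 2; set rho := \sum_i w i ^+ 2.
pose u := r + rho; pose s := 2 * \sum_i y i * w i.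
have r0 : 0 <= r by exact: sumsq_ge0.
have rho0 : 0 <= rho by exact: sumsq_ge0.
have u0 : 0 <= u by rewrite addr_ge0.
have ep : \sum_i (y i + w i) ^+ 2 = u + s.
  rewrite /u /s /r /rho mulr_sumr -!big_split /=; apply: eq_bigr => i _; ring.
have em : \sum_i (y i - w i) ^+ 2 = u - s.
  rewrite /u /s /r /rho mulr_sumr -sumrN -!big_split /=; apply: eq_bigr => i _; ring.
have normpart : 2 * u ^+ d <= (u + s) ^+ d + (u - s) ^+ d.
  by apply: midpoint_exprn; rewrite -?ep -?em sumsq_ge0.
have gain : r ^+ d + rho * u ^+ d.-1 <= u ^+ d.
  rewrite -(prednK d_gt0) !exprS /= [u * _]mulrDl lerD2r.
  by rewrite ler_wpM2l // lerXn2r ?nnegrE // lerDl.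
pose F (A : {set 'I_(2 * d)}) := form (fun a => if a \in A then w else y).
have plus : form (fun _ i => y i + w i) = \sum_(A : {set 'I_(2 * d)}) F A.
  under [RHS]eq_bigr => A _ do rewrite -[F A]mul1r -(expr1n R #|A|).
  rewrite -sign_form_diag_add; apply: eq_sign_form => a i.
  by rewrite mul1r.
have minus : form (fun _ i => y i - w i) =
    \sum_(A : {set 'I_(2 * d)}) (-1) ^+ #|A| * F A.
  rewrite -sign_form_diag_add; apply: eq_sign_form => a i.
  by rewrite mulN1r.
have F0 : F set0 = form (fun=> y).
  by apply: eq_sign_form => a i; rewrite inE.
have FA A : A != set0 -> (1 + (-1) ^+ #|A|) * F A <= 2 * (sigma * (rho * u ^+ d.-1)).
  move=> A0; have [oddA|evenA] := boolP (odd #|A|).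
    by rewrite -signr_odd oddA expr1 subrr mul0r !mulr_ge0 ?exprn_ge0.
  rewrite -signr_odd (negPf evenA) expr0 -[1 + 1]/(2%:R) ler_pM2l //.
  apply: le_trans (bound _) _; rewrite ler_wpM2l //.
  have -> : \prod_a enorm (if a \in A then w else y) =
      enorm w ^+ #|A| * enorm y ^+ (2 * d - #|A|).
    rewrite (bigID (mem A)) /= -prodr_const; congr (_ * _).
      by apply: eq_bigr => a ->.
    rewrite (eq_bigr (fun=> enorm y)) => [|a /negPf-> //].
    rewrite prodr_const; congr (_ ^+ _).
    by have := cardC (mem A); rewrite card_ord => e; rewrite -[X in (X - _)%N]e addKn.
  have [j [jA j0 jd]] : exists j, [/\ #|A| = (2 * j)%N, (0 < j)%N & (j <= d)%N].
    move: (max_card A) A0 evenA; rewrite card_ord -cards_eq0.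
    move: #|A| => m lem m0 /even_halfK hm.
    exists m./2; move: (m./2) hm => j hj; split; lia.
  rewrite jA -mulnBr !exprM !enorm_sqr -/rho -/r.
  rewrite -(prednK j0) exprS -mulrA ler_wpM2l //.
  have -> : d.-1 = (j.-1 + (d - j))%N by lia.
  rewrite prednK // exprD ler_pM ?exprn_ge0 // lerXn2r ?nnegrE // ?lerDl ?lerDr //.
have sumF : form (fun _ i => y i + w i) + form (fun _ i => y i - w i)
    - 2 * form (fun=> y) <= 4 ^+ d * (2 * (sigma * (rho * u ^+ d.-1))).
  rewrite plus minus -big_split /= (bigD1 set0) //= F0 cards0 expr0 mul1r.
  rewrite -[form _ + form _]mulr2n -[_ *+ 2]mulr_natl addrAC subrr add0r.
  have c0 : 0 <= 2 * (sigma * (rho * u ^+ d.-1)) by rewrite !mulr_ge0 ?exprn_ge0.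
  apply: (@le_trans _ _ (\sum_(A : {set 'I_(2 * d)}) 2 * (sigma * (rho * u ^+ d.-1)))).
    rewrite [leRHS](bigD1 set0) //= -[leLHS]add0r lerD //.
    apply: ler_sum => B B0; have := FA B B0.
    by rewrite mulrDl mul1r.
  by rewrite sumr_const -cardsT -powersetT card_powerset cardsT card_ord expnM
    -[leLHS]mulr_natl natrX.
rewrite /f ep em -/r.
have c0 : 0 <= rho * u ^+ d.-1 by rewrite mulr_ge0 ?exprn_ge0.
have e1 := ler_wpM2l eps0 sumF.
have e2 := ler_wpM2r c0 small.
move: normpart gain e1 e2; rewrite mul1r.
set V := rho * u ^+ d.-1; set ud := u ^+ d.
set p1 := (u + s) ^+ d; set p2 := (u - s) ^+ d; set rd := r ^+ d.
set g := form (fun=> y); set gp := form _; set gm := form _.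
set W := (4 : R) ^+ d.
(* lra must see these quantities as atoms *)
clearbody V ud p1 p2 rd g gp gm W; clear=> ? ? h1 h2.
have h3 : eps * (W * (2 * (sigma * V))) = 2 * (eps * sigma * W * V) by ring.
rewrite h3 in h1; lra.
Qed.

End Perturbation.

(** * Forms on the vertices of the cube *)

Section Cube.
Variables (R : realType) (n : nat).
Implicit Types A B C J : {set 'I_n}.

(** The vertices of the cube {-1,1}^n are indexed by the set of their negative
coordinates. *)
Definition vertex B (i : 'I_n) : R := (-1) ^+ (i \in B).

(** The squarefree monomial with support A, evaluated at a vertex. *)
Definition walsh A B : R := \prod_i vertex B i ^+ (i \in A).

Lemma vertex_sqr B i : vertex B i ^+ 2 = 1.
Proof. by rewrite /vertex sqrr_sign. Qed.

Lemma sum_vertex_monomial (e : 'I_n -> nat) :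
  \sum_B \prod_i vertex B i ^+ e i =
    if [forall i, ~~ odd (e i)] then 2 ^+ n else 0 :> R.
Proof.
transitivity (\prod_(i < n) ((-1) ^+ e i + 1 : R)).
  rewrite bigA_distr; apply: eq_bigr => B _; apply: eq_bigr => i _.
  by rewrite /vertex; case: (i \in B); rewrite ?expr0 ?expr1n.
case: forallP => [even|/forallP]; last first.
  rewrite negb_forall => /existsP[i]; rewrite negbK => oddi.
  by rewrite (bigD1 i) //= -signr_odd oddi expr1 addNr mul0r.
rewrite (eq_bigr (fun=> 2)) => [|i _]; first by rewrite prodr_const card_ord.
by rewrite -signr_odd (negPf (even i)) expr0.
Qed.

Lemma walsh_orthogonal A C :
  \sum_B walsh A B * walsh C B = if A == C then 2 ^+ n else 0.
Proof.
rewrite (eq_bigr (fun B => \prod_i vertex B i ^+ ((i \in A) + (i \in C)))).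
  rewrite sum_vertex_monomial; congr (if _ then _ else _).
  apply/forallP/eqP => [h|-> i]; last by rewrite addnn odd_double.
  by apply/setP => i; have := h i; case: (i \in A); case: (i \in C).
by move=> B _; rewrite -big_split; apply: eq_bigr => i _; rewrite exprD.
Qed.

(** The sum is nonzero exactly when every i lies in an even number of the three sets.
Then J is contained in the union of A and C, and its size 2 d forces A and C to
be disjoint of size d. *)
Lemma walsh_triple d A C (J : {set 'I_n}) : #|J| = (2 * d)%N -> (#|A| <= d)%N -> (#|C| <= d)%N ->
  \sum_B walsh A B * walsh C B * walsh J B =
    if [&& #|A| == d, #|C| == d, [disjoint A & C] & J == A :|: C]
    then 2 ^+ n else 0.
Proof.
move=> Jd Ad Cd.
rewrite (eq_bigr (fun B =>
    \prod_i vertex B i ^+ ((i \in A) + (i \in C) + (i \in J)))); last first.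
  by move=> B _; rewrite -!big_split; apply: eq_bigr => i _; rewrite !exprD.
rewrite sum_vertex_monomial; congr (if _ then _ else _).
apply/forallP/idP => [h|/and4P[_ _ /pred0P dis /eqP-> i]]; last first.
  by rewrite inE; have := dis i; rewrite /=; case: (i \in A); case: (i \in C).
have sub : J \subset A :|: C.
  apply/subsetP => i iJ; rewrite inE; have := h i; rewrite iJ.
  by case: (i \in A); case: (i \in C).
have := subset_leq_card sub; have := cardsUI A C; rewrite Jd => UI le.
have JE : J == A :|: C by rewrite eqEcard sub Jd; lia.
rewrite JE andbT -setI_eq0 -cards_eq0; apply/and3P; split; lia.
Qed.

(** On the cube only the parities of the exponents of a monomial matter, and the
set of variables with odd exponent has at most d elements. *)
Lemma dhomog_on_cube d (h : {mpoly R[n]}) : h \is d.-homog ->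
  exists2 c : {set 'I_n} -> R, forall A, (d < #|A|)%N -> c A = 0
    & forall B, h.@[vertex B] = \sum_A c A * walsh A B.
Proof.
move=> /dhomogP hd; pose o (m : 'X_{1..n}) := [set i | odd (m i)].
exists (fun A => \sum_(m <- msupp h | o m == A) h@_m) => [A dA|B].
  rewrite big1_seq // => m /andP[/eqP omA /hd md]; exfalso.
  have e : (\sum_i m i = d)%N by rewrite -mdegE.
  move: dA; rewrite -e -omA ltnNge => /negP; apply.
  rewrite -sum1_card big_mkcond; apply: leq_sum => i _.
  by rewrite inE; case: (m i) => // k; case: ifP.
rewrite mevalE (partition_big o predT) //=; apply: eq_bigr => A _.
rewrite mulr_suml; apply: eq_bigr => m /eqP <-; congr (_ * _).
apply: eq_bigr => i _; rewrite inE -[in LHS](odd_double_half (m i)) exprD.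
by rewrite -mul2n exprM vertex_sqr expr1n mulr1.
Qed.

Lemma sum_sqr_on_cube (c : {set 'I_n} -> R) :
  \sum_B (\sum_A c A * walsh A B) ^+ 2 = 2 ^+ n * \sum_A c A ^+ 2.
Proof.
transitivity (\sum_B \sum_A \sum_C c A * c C * (walsh A B * walsh C B)).
  apply: eq_bigr => B _; rewrite expr2 mulr_suml; apply: eq_bigr => A _.
  by rewrite mulr_sumr; apply: eq_bigr => C _; ring.
rewrite exchange_big /= mulr_sumr; apply: eq_bigr => A _.
rewrite exchange_big /= (bigD1 A) //= [X in _ + X]big1 => [|C CA].
  by rewrite addr0 -mulr_sumr walsh_orthogonal eqxx mulrC expr2.
by rewrite -mulr_sumr walsh_orthogonal eq_sym (negPf CA) mulr0.
Qed.

Lemma sum_sqr_walsh_on_cube d (T : {set 'I_n} -> R) (c : {set 'I_n} -> R) :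
  (forall A, (d < #|A|)%N -> c A = 0) ->
  \sum_B (\sum_A c A * walsh A B) ^+ 2 *
     (\sum_(J : {set 'I_n} | #|J| == (2 * d)%N) T J * walsh J B) =
  2 ^+ n * \sum_(A : {set 'I_n} | #|A| == d) \sum_(C : {set 'I_n} | #|C| == d)
     if [disjoint A & C] then T (A :|: C) * (c A * c C) else 0.
Proof.
move=> c0.
transitivity (\sum_B \sum_A \sum_C \sum_(J : {set 'I_n} | #|J| == (2 * d)%N)
   T J * (c A * c C) * (walsh A B * walsh C B * walsh J B)).
  apply: eq_bigr => B _; rewrite expr2 -mulrA mulr_suml; apply: eq_bigr => A _.
  rewrite mulr_suml mulr_sumr; apply: eq_bigr => C _.
  by rewrite !mulr_sumr; apply: eq_bigr => J _; ring.
pose term A C := if [&& #|A| == d, #|C| == d & [disjoint A & C]]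
  then 2 ^+ n * (T (A :|: C) * (c A * c C)) else 0.
transitivity (\sum_A \sum_C term A C).
  rewrite exchange_big /=; apply: eq_bigr => A _.
  rewrite exchange_big /=; apply: eq_bigr => C _.
  rewrite exchange_big /=.
  have [dA|Ad] := ltnP d #|A|.
    rewrite /term gtn_eqF // big1 // => J _.
    by rewrite big1 // => B _; rewrite (c0 A) // mul0r mulr0 mul0r.
  have [dC|Cd] := ltnP d #|C|.
    rewrite /term (gtn_eqF dC) andbF big1 // => J _.
    by rewrite big1 // => B _; rewrite (c0 C) // !mulr0 mul0r.
  under eq_bigr => J /eqP Jd do rewrite -mulr_sumr (walsh_triple Jd Ad Cd).
  rewrite /term; case: ifP => [/and3P[Ae Ce dis]|no]; last first.
    rewrite big1 // => J _; case: ifP => [/and4P[a1 a2 a3 _]|_]; last exact: mulr0.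
    by rewrite a1 a2 a3 in no.
  rewrite (bigD1 (A :|: C)) /=; last first.
    have := cardsUI A C; move: (dis); rewrite -setI_eq0 => /eqP ->.
    by rewrite cards0 addn0 (eqP Ae) (eqP Ce) => ->; rewrite addnn mul2n.
  rewrite Ae Ce dis eqxx /= [X in _ + X]big1 => [|J /andP[_ /negPf->]].
    by rewrite addr0 mulrC.
  by rewrite mulr0.
rewrite mulr_sumr [RHS]big_mkcond; apply: eq_bigr => A _; rewrite /term.
case: (#|A| == d) => /=; last by rewrite big1.
rewrite mulr_sumr [RHS]big_mkcond; apply: eq_bigr => C _.
by case: (#|C| == d) => //=; case: ifP => // _; rewrite mulr0.
Qed.

End Cube.

(** * The two forms attached to a choice of signs *)

Lemma double_expRN1_lt1 (R : realType) : expR (- 1) + expR (- 1) < 1 :> R.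
Proof.
have e2 : 1 + 1 < expR (1 : R) by apply: expR_gt1Dx; rewrite oner_neq0.
have e1 : expR (- 1) * expR 1 = 1 :> R by rewrite -expRD addNr expR0.
have e0 : 0 < expR (- 1) :> R by exact: expR_gt0.
nra.
Qed.

Section SignForms.
Variables (R : realType) (n d : nat).
Implicit Types (T : {ffun {set 'I_n} -> bool}).

Definition injection_form T (x : 'I_(2 * d) -> 'I_n -> R) : R :=
  sign_form (fun f : {ffun 'I_(2 * d) -> 'I_n} => injectiveb f)
    (fun f => [set f a | a : 'I_(2 * d)]) (fun a f => f a) T x.

(** Indexing the d-subsets by an ordinal makes the type of variables of the bilinear
form have cardinal 'C(n, d), whose square root enters its norm. *)
Definition subset_index := 'I_#|[set A : {set 'I_n} | #|A| == d]|.

Definition subset_of (i : subset_index) : {set 'I_n} := enum_val i.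

Definition disjoint_pair_form T (x : 'I_2 -> subset_index -> R) : R :=
  sign_form
    (fun p : subset_index * subset_index => [disjoint subset_of p.1 & subset_of p.2])
    (fun p => subset_of p.1 :|: subset_of p.2)
    (fun a p => if a == ord0 then p.1 else p.2) T x.

Lemma card_subset_of i : #|subset_of i| = d.
Proof. by have := enum_valP i; rewrite inE => /eqP. Qed.

(** Injections with image J are functions with values in J. *)
Lemma injection_fiber_le (J : {set 'I_n}) :
  (#|[pred f : {ffun 'I_(2 * d) -> 'I_n} | injectiveb f &
      [set f a | a : 'I_(2 * d)] == J]| <= (2 * d) ^ (2 * d))%N.
Proof.
case: (pickP [pred f : {ffun 'I_(2 * d) -> 'I_n} | injectiveb f &
      [set f a | a : 'I_(2 * d)] == J]) => [f0 /= /andP[/injectiveP inj0 /eqP im0]|none].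
  have cJ : #|J| = (2 * d)%N by rewrite -im0 card_imset // card_ord.
  rewrite -[X in (X ^ _)%N]cJ -[X in (_ ^ X)%N](card_ord (2 * d)) -card_ffun_on.
  apply: subset_leq_card; apply/subsetP => f; rewrite inE => /andP[_ /eqP <-].
  by apply/ffun_onP => a; apply: imset_f.
by rewrite eq_card0.
Qed.

(** A pair in the fiber over J is determined by its first component, a subset of J. *)
Lemma disjoint_pair_fiber_le (J : {set 'I_n}) :
  (#|[pred p : subset_index * subset_index | [disjoint subset_of p.1 & subset_of p.2]
      & subset_of p.1 :|: subset_of p.2 == J]| <= 2 ^ (2 * d))%N.
Proof.
set F := [pred p | _ & _].
case: (pickP F) => [p0 /= /andP[dis0 /eqP U0]|none]; last by rewrite (eq_card0 none).
have cJ : #|J| = (2 * d)%N.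
  rewrite -U0; have := cardsUI (subset_of p0.1) (subset_of p0.2).
  move: dis0; rewrite -setI_eq0 => /eqP->.
  by rewrite cards0 addn0 !card_subset_of => ->; rewrite addnn mul2n.
have compl p : p \in F -> subset_of p.2 = J :\: subset_of p.1.
  rewrite inE => /andP[dis /eqP <-]; rewrite setDUl setDv set0U.
  by apply/esym/setDidPl; rewrite disjoint_sym.
have inj : {in F &, injective (fun p => subset_of p.1)}.
  move=> [p1 p2] [q1 q2] Fp Fq /= e1.
  have := compl _ Fp; have := compl _ Fq; rewrite /= -e1 => <- e2.
  by congr (_, _); apply: enum_val_inj.
rewrite -(card_in_imset inj).
have <- : #|powerset J| = (2 ^ (2 * d))%N by rewrite card_powerset cJ.
apply: subset_leq_card; apply/subsetP => A /imsetP[p]; rewrite !inE.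
by move=> /andP[_ /eqP <-] ->; apply: subsetUl.
Qed.

Lemma ffact_le m k : (m ^_ k <= m ^ k)%N.
Proof.
rewrite ffact_prod -[X in (_ <= _ ^ X)%N]card_ord -prod_nat_const.
by apply: leq_prod => i _; rewrite leq_subr.
Qed.

(** The potentials of the two forms have means at most exp (-1), so their sum has mean
below 1 and takes a value below 1. *)
Lemma exists_small_signs (Q : nat) : (0 < d)%N -> (0 < Q)%N -> (n <= Q ^ 2)%N ->
  exists T,
    (forall x, injection_form T x <=
      2 ^+ (2 * d) * (2 * (2 * d) ^ (2 * d) + 6 * (2 * d) + 1)%:R * Q%:R *
        \prod_a enorm (x a)) /\
    (forall x, disjoint_pair_form T x <=
      2 ^+ 2 * (2 * 2 ^ (2 * d) + 6 * 2 + 1)%:R * (Q ^ d)%:R *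
        \prod_a enorm (x a)).
Proof.
move=> d0 Q0 nQ.
have [|||Phi1 [pos1 sum1 bound1]] := @sign_form_potential R
    {ffun 'I_(2 * d) -> 'I_n} {set 'I_n} 'I_n (fun f => injectiveb f)
    (fun f => [set f a | a : 'I_(2 * d)]) (2 * d) (fun a f => f a)
    ((2 * d) ^ (2 * d)) Q injection_fiber_le _ _ Q0 _.
- by move=> f g _ _ fg; apply/ffunP.
- by rewrite muln_gt0.
- by rewrite card_ord.
have [||||Phi2 [pos2 sum2 bound2]] := @sign_form_potential R
    (subset_index * subset_index)%type {set 'I_n} subset_index
    (fun p => [disjoint subset_of p.1 & subset_of p.2])
    (fun p => subset_of p.1 :|: subset_of p.2) 2
    (fun a p => if a == ord0 then p.1 else p.2) (2 ^ (2 * d)) (Q ^ d)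
    disjoint_pair_fiber_le _ _ _ _.
- by move=> [p1 p2] [q1 q2] _ _ pq; congr (_, _); [apply: (pq ord0)|apply: (pq ord_max)].
- by [].
- by rewrite expn_gt0 Q0.
- rewrite card_ord card_draws card_ord -expnM mulnC expnM.
  apply: leq_trans (_ : n ^ d <= _)%N; last by rewrite leq_exp2r.
  apply: leq_trans (ffact_le _ _); rewrite -bin_ffact.
  by rewrite leq_pmulr ?fact_gt0.
have [T small] : exists T, Phi1 T + Phi2 T < 1.
  case: (pickP (fun T => Phi1 T + Phi2 T < 1)) => [T ?|big]; first by exists T.
  exfalso.
  have : \sum_(T : {ffun {set 'I_n} -> bool}) (1 : R) <=
         \sum_(T : {ffun {set 'I_n} -> bool}) (Phi1 T + Phi2 T).
    by apply: ler_sum => T _; rewrite leNgt big.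
  rewrite big_split sumr_const card_ffun card_bool natrX.
  apply/negP; rewrite -ltNge; apply: le_lt_trans (lerD sum1 sum2) _.
  by rewrite -mulrDr gtr_pMr ?exprn_gt0 // double_expRN1_lt1.
exists T; split.
  by apply: bound1; apply: le_lt_trans small; rewrite lerDl.
by apply: bound2; apply: le_lt_trans small; rewrite lerDr.
Qed.

Lemma disjoint_pair_formE T (u v : subset_index -> R) :
  disjoint_pair_form T (fun a => if a == ord0 then u else v) =
  \sum_i \sum_j if [disjoint subset_of i & subset_of j]
    then (-1) ^+ T (subset_of i :|: subset_of j) * (u i * v j) else 0.
Proof.
rewrite /disjoint_pair_form /sign_form big_mkcond.
rewrite (pair_bigA _ (fun i j => if [disjoint subset_of i & subset_of j]
    then (-1) ^+ T (subset_of i :|: subset_of j) * (u i * v j) else 0)) /=.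
apply: eq_bigr => p _; case: ifP => // _.
by rewrite !big_ord_recl big_ord0 mulr1.
Qed.

(** In the Walsh coefficients c of h on the cube, the sum is 2^n times
lam sum_A c_A^2 plus the value at (c, c) of the bilinear form, and the upper bound
at (-c, c) is a lower bound at (c, c). *)
Lemma square_functional_ge0 T (lam : R) (h : {mpoly R[n]}) :
  (forall x, disjoint_pair_form T x <= lam * \prod_a enorm (x a)) ->
  0 <= lam -> h \is d.-homog ->
  0 <= \sum_B h.@[@vertex R n B] ^+ 2 * (lam +
     \sum_(J : {set 'I_n} | #|J| == (2 * d)%N) (-1) ^+ T J * walsh R J B).
Proof.
move=> bound lam0 /dhomog_on_cube[c c0 hc].
under eq_bigr => B _ do rewrite hc mulrDr mulrC.
rewrite big_split /= -mulr_sumr sum_sqr_on_cube.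
rewrite (sum_sqr_walsh_on_cube (fun J => (-1) ^+ T J) c0).
rewrite mulrCA -mulrDr mulr_ge0 ?exprn_ge0 //.
pose u (i : subset_index) := c (subset_of i).
have -> : \sum_(A : {set 'I_n} | #|A| == d) \sum_(C : {set 'I_n} | #|C| == d)
    (if [disjoint A & C] then (-1) ^+ T (A :|: C) * (c A * c C) else 0) =
    - disjoint_pair_form T (fun a => if a == ord0 then (fun i => - u i) else u).
  rewrite disjoint_pair_formE -sumrN.
  transitivity (\sum_(A in [set A : {set 'I_n} | #|A| == d])
    \sum_(C in [set A : {set 'I_n} | #|A| == d])
    (if [disjoint A & C] then (-1) ^+ T (A :|: C) * (c A * c C) else 0)).
    apply: eq_big => [A|A _]; first by rewrite inE.
    by apply: eq_bigl => C; rewrite inE.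
  rewrite big_enum_val; apply: eq_bigr => i _.
  rewrite big_enum_val -sumrN; apply: eq_bigr => j _.
  by rewrite /u /subset_of; case: ifP => _; rewrite ?oppr0 // mulNr mulrN opprK.
rewrite subr_ge0; apply: le_trans (bound _) _.
rewrite ler_wpM2l // !big_ord_recl big_ord0 mulr1 /=.
have -> : enorm (fun i => - u i) = enorm u.
  by rewrite /enorm; under eq_bigr => i _ do rewrite sqrrN.
rewrite -expr2 enorm_sqr /u /subset_of.
rewrite -(big_enum_val (fun A => c A ^+ 2)) /=.
rewrite [leRHS](bigID (mem [set A : {set 'I_n} | #|A| == d])) /= lerDl.
by apply: sumr_ge0 => A _; rewrite sqr_ge0.
Qed.

Lemma injection_form_vertex T B :
  injection_form T (fun=> @vertex R n B) =
  \sum_(f : {ffun 'I_(2 * d) -> 'I_n} | injectiveb f)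
     (-1) ^+ T [set f a | a : 'I_(2 * d)] * walsh R [set f a | a : 'I_(2 * d)] B.
Proof.
apply: eq_bigr => f /injectiveP inj; congr (_ * _).
rewrite /walsh (bigID (mem [set f a | a : 'I_(2 * d)])) /= [X in _ * X]big1.
  rewrite mulr1 big_imset /=; last by move=> a b _ _; apply: inj.
  by apply: eq_bigr => a _; rewrite imset_f ?expr1.
by move=> i /negPf->.
Qed.

(** The injections each contribute T(im f)^2 = 1 to the correlation of the form with
sum_J T_J x^J, while both have mean zero over the cube. *)
Lemma functional_value T (lam eps s : R) : (0 < d)%N ->
  \sum_B (s - eps * injection_form T (fun=> @vertex R n B)) *
    (lam + \sum_(J : {set 'I_n} | #|J| == (2 * d)%N) (-1) ^+ T J * walsh R J B)
  = 2 ^+ n * (lam * s - eps * (n ^_ (2 * d))%:R).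
Proof.
move=> d0; pose w B := \sum_(J : {set 'I_n} | #|J| == (2 * d)%N)
  (-1) ^+ T J * walsh R J B.
pose q B := injection_form T (fun=> @vertex R n B).
have w0 J : J != set0 -> \sum_B walsh R J B = 0.
  move=> J0; have := walsh_orthogonal R J set0; rewrite (negPf J0) => e; rewrite -[RHS]e.
  apply: eq_bigr => B _; have -> : walsh R set0 B = 1; last by rewrite mulr1.
  by rewrite /walsh big1 // => i _; rewrite inE.
have cn0 (J : {set 'I_n}) : #|J| = (2 * d)%N -> J != set0.
  by move=> cJ; rewrite -cards_eq0 cJ -lt0n muln_gt0.
have imf (f : {ffun 'I_(2 * d) -> 'I_n}) : injectiveb f ->
    #|[set f a | a : 'I_(2 * d)]| = (2 * d)%N.
  by move=> /injectiveP inj; rewrite card_imset // card_ord.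
have sw : \sum_B w B = 0.
  rewrite exchange_big big1 //= => J /eqP /cn0 J0.
  by rewrite -mulr_sumr w0 // mulr0.
have sq : \sum_B q B = 0.
  under eq_bigr => B _ do rewrite /q injection_form_vertex.
  rewrite exchange_big big1 //= => f /imf/cn0 f0.
  by rewrite -mulr_sumr w0 // mulr0.
have sqw : \sum_B q B * w B = 2 ^+ n * (n ^_ (2 * d))%:R.
  under eq_bigr => B _ do rewrite /q injection_form_vertex mulr_suml.
  rewrite exchange_big /=.
  rewrite (eq_bigr (fun=> 2 ^+ n)).
    rewrite sumr_const -[LHS]mulr_natr; congr (_ * _%:R).
    rewrite -[X in (_ ^_ X)%N]card_ord -[X in (X ^_ _)%N]card_ord -card_inj_ffuns.
    by apply: eq_card => f; rewrite !inE.
  move=> f injf; under eq_bigr => B _ do rewrite mulr_sumr.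
  rewrite exchange_big /= (bigD1 [set f a | a : 'I_(2 * d)]) /= ?imf //.
  rewrite [X in _ + X]big1 => [|J /andP[_ Jf]].
    rewrite addr0; under eq_bigr => B _ do rewrite mulrACA -expr2 sqrr_sign mul1r.
    by rewrite walsh_orthogonal eqxx.
  under eq_bigr => B _ do rewrite mulrACA.
  by rewrite -mulr_sumr walsh_orthogonal eq_sym (negPf Jf) mulr0.
transitivity (\sum_B (s * lam + s * w B - (eps * lam) * q B - eps * (q B * w B))).
  by apply: eq_bigr => B _; rewrite -/(q B) -/(w B); ring.
rewrite !big_split /= !sumrN -!mulr_sumr sw sq sqw sumr_const.
rewrite -cardsT -powersetT card_powerset cardsT card_ord.
by rewrite -[_ *+ _]mulr_natl natrX; ring.
Qed.

End SignForms.

Section Witness.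
Variables (R : realType) (n d : nat) (T : {ffun {set 'I_n} -> bool}) (eps : R).

Definition witness_form : {mpoly R[n]} :=
  (\sum_i 'X_i ^+ 2) ^+ d -
  eps *: \sum_(f : {ffun 'I_(2 * d) -> 'I_n} | injectiveb f)
     (-1) ^+ T [set f a | a : 'I_(2 * d)] *: \prod_a 'X_(f a).

Lemma witness_formE v : witness_form.@[v] =
  (\sum_i v i ^+ 2) ^+ d - eps * injection_form (d := d) T (fun=> v).
Proof.
rewrite /witness_form mevalB mevalZ rmorphXn /= !raddf_sum /=.
congr (_ ^+ _ - _ * _).
  by apply: eq_bigr => i _; rewrite rmorphXn /= mevalXU.
apply: eq_bigr => f _; rewrite mevalZ rmorph_prod /=; congr (_ * _).
by apply: eq_bigr => a _; rewrite mevalXU.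
Qed.

Lemma witness_form_homog : witness_form \is (2 * d)%N.-homog.
Proof.
have X1 i : ('X_i : {mpoly R[n]}) \is 1%N.-homog by rewrite dhomogX; apply/eqP/mdeg1.
rewrite rpredB //.
  by apply: dhomogMn; apply: rpred_sum => i _; exact: (dhomogMn 2 (X1 i)).
rewrite rpredZ // rpred_sum // => f _; rewrite rpredZ //.
have prodX s : \prod_(a <- s) ('X_(f a) : {mpoly R[n]}) \is (size s).-homog.
  elim: s => [|a s IH]; first by rewrite big_nil dhomog1.
  by rewrite big_cons -[size _]add1n dhomogM.
by have := prodX (enum 'I_(2 * d)); rewrite size_enum_ord big_enum.
Qed.

End Witness.

(** * Properties of the form and choice of the constants *)

(** The functional of [square_functional_ge0] is nonnegative on sums of squares and
negative on the form. *)
Lemma witness_form_not_sos (R : realType) (n d : nat)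
    (T : {ffun {set 'I_n} -> bool}) (lam eps : R) :
  (0 < d)%N -> 0 <= lam ->
  (forall x : 'I_2 -> subset_index n d -> R,
     disjoint_pair_form T x <= lam * \prod_a enorm (x a)) ->
  lam * n%:R ^+ d < eps * (n ^_ (2 * d))%:R ->
  ~ sum_of_squares_of_forms d (witness_form d T eps).
Proof.
move=> d0 lam0 bound gap [s [sh ps]].
have := functional_value T lam eps (n%:R ^+ d) d0.
set L := \sum_B _ => LE.
have Lneg : L < 0 by rewrite LE pmulr_rlt0 ?exprn_gt0 // subr_lt0.
suff : 0 <= L by rewrite leNgt Lneg.
have -> : L = \sum_(q <- s) \sum_B q.@[@vertex R n B] ^+ 2 * (lam +
     \sum_(J : {set 'I_n} | #|J| == (2 * d)%N) (-1) ^+ T J * walsh R J B).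
  rewrite exchange_big; apply: eq_bigr => B _ /=; rewrite -mulr_suml.
  congr (_ * _).
  have <- : (witness_form d T eps).@[@vertex R n B] =
      n%:R ^+ d - eps * injection_form (d := d) T (fun=> @vertex R n B).
    rewrite witness_formE; congr (_ ^+ _ - _).
    by under eq_bigr => i _ do rewrite vertex_sqr; rewrite sumr_const card_ord.
  rewrite ps raddf_sum /=; apply: eq_bigr => q _.
  by rewrite rmorphXn.
rewrite big_seq sumr_ge0 // => q qs.
by apply: (square_functional_ge0 bound lam0); apply: sh.
Qed.

Lemma witness_form_convex (R : realType) (n d : nat)
    (T : {ffun {set 'I_n} -> bool}) (sigma eps : R) :
  (0 < d)%N -> 0 <= sigma -> 0 <= eps -> eps * sigma * 4 ^+ d <= 1 ->
  (forall x : 'I_(2 * d) -> 'I_n -> R,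
     injection_form T x <= sigma * \prod_a enorm (x a)) ->
  convex_poly (witness_form d T eps).
Proof.
move=> d0 sigma0 eps0 small bound; apply: convex_of_midpoint => y w.
by rewrite !witness_formE; apply: perturbed_norm_midpoint bound.
Qed.

Lemma ffact_lower m k : (2 * k <= m)%N -> (m ^ k <= 2 ^ k * m ^_ k)%N.
Proof.
move=> km; rewrite ffact_prod.
rewrite -[X in (_ ^ X)%N](card_ord k) -[X in (_ <= _ ^ X * _)%N](card_ord k).
rewrite -!prod_nat_const -big_split /=.
by apply: leq_prod => i _; have := ltn_ord i; lia.
Qed.

Lemma square_above n : (0 < n)%N -> exists2 Q, (n <= Q ^ 2)%N & (Q ^ 2 <= 4 * n)%N.
Proof.
move=> n0; have ex : exists Q, (n <= Q ^ 2)%N by exists n; nia.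
case: (ex_minnP ex) => Q hQ min; exists Q => //.
case: Q hQ min => [|Q] hQ min; first by lia.
have [|lt] := leqP n (Q ^ 2); first by move/min; lia.
by case: Q lt hQ {min} => [|Q] lt hQ; nia.
Qed.

(** With Q of order sqrt n, the left side has order n^(3d/2 + 1/2) and the right side
order n^(2d); d >= 2 makes Q^(2d) at least Q^(d+1) Q, so it is enough that Q
exceeds the constants. *)
Lemma gap_of_large (n d Q C : nat) : (2 <= d)%N -> (4 * d <= n)%N ->
  (n <= Q ^ 2)%N -> (Q ^ 2 <= 4 * n)%N -> (64 ^ d * C < Q)%N ->
  (4 ^ d * C * Q ^ d.+1 * n ^ d < n ^_ (2 * d))%N.
Proof.
move=> d2 dn nQ Qn CQ.
have n0 : (0 < n)%N by lia.
have Q0 : (0 < Q)%N by apply: leq_ltn_trans CQ.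
have low := @ffact_lower n (2 * d) ltac:(lia).
rewrite -(ltn_pmul2l (_ : 0 < 2 ^ (2 * d))%N) ?expn_gt0 //.
apply: leq_trans low.
have -> : (n ^ (2 * d) = n ^ d * n ^ d)%N by rewrite mul2n -addnn expnD.
rewrite !mulnA ltn_pmul2r ?expn_gt0 ?n0 //.
rewrite -(ltn_pmul2l (_ : 0 < 4 ^ d)%N) ?expn_gt0 //.
rewrite -expnMn.
have Qd : (Q ^ (2 * d) <= (4 * n) ^ d)%N by rewrite expnM leq_exp2r //; lia.
apply: leq_trans Qd.
have -> : (4 ^ d * (2 ^ (2 * d) * 4 ^ d * C * Q ^ d.+1) = 64 ^ d * C * Q ^ d.+1)%N.
  by rewrite expnM !mulnA -!expnMn.
apply: leq_trans (_ : Q * Q ^ d.+1 <= _)%N.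
  by rewrite ltn_pmul2r ?expn_gt0 ?Q0.
by rewrite -expnS leq_pexp2l //; lia.
Qed.

Theorem mainTheorem4 (R : realType) (d : nat) (hd : (2 <= d)%N) :
  exists n0 : nat, forall n : nat, (n0 <= n)%N ->
    exists p : {mpoly R[n]},
      p \is (2 * d)%N.-homog /\ convex_poly p /\ ~ sum_of_squares_of_forms d p.
Proof.
pose C1 := (2 ^ (2 * d) * (2 * (2 * d) ^ (2 * d) + 6 * (2 * d) + 1))%N.
pose C2 := (2 ^ 2 * (2 * 2 ^ (2 * d) + 6 * 2 + 1))%N.
exists ((64 ^ d * (C1 * C2)) ^ 2 + 4 * d).+1 => n nlarge.
have d0 : (0 < d)%N by lia.
have [Q nQ Qn] := @square_above n ltac:(lia).
have CQ : (64 ^ d * (C1 * C2) < Q)%N.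
  by rewrite -ltn_sqr; lia.
have Q0 : (0 < Q)%N by apply: leq_ltn_trans CQ.
have [T [bound1 bound2]] := @exists_small_signs R n d Q d0 Q0 nQ.
pose sigma : R := (C1 * Q)%:R; pose lam : R := (C2 * Q ^ d)%:R.
have sigma_gt0 : 0 < sigma.
  by rewrite ltr0n !muln_gt0 !expn_gt0 Q0 addn1.
pose eps : R := (sigma * 4 ^+ d)^-1.
exists (witness_form d T eps); split; first exact: witness_form_homog.
split.
  apply: (@witness_form_convex _ _ _ _ sigma) => //.
  - by rewrite invr_ge0 mulr_ge0 ?exprn_ge0 // ltW.
  - by rewrite -mulrA mulVf // mulf_neq0 ?expf_neq0 ?gt_eqF.
  - by move=> x; have := bound1 x; rewrite /sigma /C1 !natrM natrX.
apply: (@witness_form_not_sos _ _ _ _ lam) => //.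
  by move=> x; have := bound2 x; rewrite /lam /C2 !natrM !natrX.
rewrite /eps [ltRHS]mulrC ltr_pdivlMr ?mulr_gt0 ?exprn_gt0 //.
have prodE (a b : nat) : (b * Q ^ d)%:R * n%:R ^+ d * ((a * Q)%:R * 4 ^+ d) =
    (4 ^ d * (a * b) * Q ^ d.+1 * n ^ d)%:R :> R.
  by rewrite !natrM !natrX exprS; ring.
by rewrite /lam /sigma prodE ltr_nat; apply: gap_of_large => //; lia.
Qed.
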